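(* Let $m\ge 3$ be an integer and let $\varepsilon\in\left(0,\frac{m-2}{m-1}\right)$ be a constant. Then for all sufficiently large $\beta$ (depending on $m$ and $\varepsilon$) the utilitarian distortion of the Random Dictator rule with $m$ candidates under the Plackett–Luce model with parameter $\beta$ satisfies $$\mathcal{D}_{m,\beta}(\mathrm{RandomDictator})\;\ge\;(1-\varepsilon)\,m .$$
   Context: Setting. $C$ is a set of $m$ candidates and $\beta\ge 1$ is a real parameter. Let $\mathcal{V}$ be a probability distribution on $[0,1]^C$ (utility vectors). For each $n$, the utility vectors $\mathbf{u}_1,\dots,\mathbf{u}_n$ of $n$ voters are drawn i.i.d. from $\mathcal{V}$, with $u_{i,j}\in[0,1]$ the utility of voter $i$ for candidate $j$. Given the utilities, each voter $i$ independently submits a random ranking $\pi_i$ of $C$ drawn from the Plackett–Luce model: positions are filled from top to bottom, and at each step a candidate $j$ is chosen among the not yet ranked candidates with probability proportional to $e^{\beta u_{i,j}}$. A voting rule $f$ maps each profile $\pi^n=(\pi_1,\dots,\pi_n)$ (for every $n$) to a probability distribution over $C$. Put $\mathrm{Util}_j=\mathbb{E}_{\mathbf{u}\sim\mathcal{V}}[u_j]$ and $\mathrm{Util}_n(f)=\mathbb{E}\big[\tfrac1n\sum_{i=1}^n u_{i,f(\pi^n)}\big]$, the expectation being over utilities, rankings and the internal randomness of $f$. The utilitarian distortion is $$\mathcal{D}_{m,\beta}(f)=\sup_{\mathcal{V}}\ \limsup_{n\to\infty}\ \frac{\max_{j\in C}\mathrm{Util}_j}{\mathrm{Util}_n(f)},$$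 with the ratio taken to be $1$ if numerator and denominator are both $0$. Random Dictator rule. Selects a voter uniformly at random and outputs that voter's top-ranked candidate; i.e. candidate $j$ is output with probability equal to the fraction of voters ranking $j$ first. *)

(* Defs.v *)
From HB Require Import structures.
From mathcomp Require Import all_boot all_order all_algebra all_fingroup.
From mathcomp Require Import all_classical all_reals all_analysis.

Set Implicit Arguments.
Unset Strict Implicit.
Unset Printing Implicit Defensive.

Import Order.TTheory GRing.Theory Num.Theory.
Import numFieldNormedType.Exports.

Local Open Scope classical_set_scope.
Local Open Scope ring_scope.

(* The law of n independent draws from P on n.-tuple T, as an iterated binary
   product measure; [iid_rectangle] below characterizes it. *)
Section iid.
Context d (T : measurableType d) (R : realType).

Definition cons_pair n (x : T * n.-tuple T) : n.+1.-tuple T :=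
  [tuple of x.1 :: x.2].

Lemma measurable_cons_pair n : measurable_fun [set: _] (@cons_pair n).
Proof. by apply: (@measurable_cons _ _ _ _ fst n snd). Qed.

HB.instance Definition _ n :=
  isMeasurableFun.Build _ _ _ _ (@cons_pair n) (@measurable_cons_pair n).

Fixpoint iid (P : probability T R) (n : nat) : probability (n.-tuple T) R :=
  match n with
  | 0 => \d_ ([tuple] : 0.-tuple T)
  | n'.+1 => distribution (P \x iid P n')%E (@cons_pair n')
  end.

Lemma iid_rectangle (P : probability T R) n (A : 'I_n -> set T) :
  (forall i, measurable (A i)) ->
  iid P n [set t | forall i, A i (tnth t i)] = (\prod_(i < n) P (A i))%E.
Proof.
elim: n A => [|n IH] A mA.
  rewrite big_ord0 /= diracE mem_set//.
  by move=> [].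
have mB : measurable [set t : n.-tuple T | forall i, A (lift ord0 i) (tnth t i)].
  rewrite (_ : [set _ | _] =
      \bigcap_(i in [set: 'I_n]) ((@tnth _ T ^~ i) @^-1` A (lift ord0 i))).
    apply: fin_bigcap_measurable => [|i _]; first exact: finite_finset.
    by rewrite -[X in measurable X]setTI; exact: measurable_tnth.
  by apply/seteqP; split => t /= Ht i; [move=> _; exact: Ht|exact: (Ht i I)].
rewrite big_ord_recl -IH//= /distribution /pushforward.
rewrite -product_measure1E//; congr (product_measure1 _ _ _).
apply/seteqP; split => -[x t] /=.
  move=> H; split; first exact: (H ord0).
  by move=> i; have := H (lift ord0 i); rewrite /cons_pair tnthS.
move=> [Hx Ht] i; case: (unliftP ord0 i) => [j|] ->; rewrite /cons_pair.
  by rewrite tnthS; exact: Ht.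
exact: Hx.
Qed.

End iid.

(* Candidates are the elements of 'I_m.  A ranking is a permutation s : 'S_m,
   with s k the candidate in position k (position 0 is the top), so that
   (s^-1)%g j is the position of candidate j.  A profile of n ballots is a
   finite function from voters to rankings. *)
Definition profile (m n : nat) := {ffun 'I_n -> 'S_m}.

Definition ranked_first m (s : 'S_m) (j : 'I_m) : bool :=
  (s^-1)%g j == 0%N :> nat.

Definition utility_vector (R : realType) (m : nat) := m.-tuple (measurableTypeR R).

Definition unit_cube (R : realType) (m : nat) : set (m.-tuple R) :=
  [set u | forall j, 0 <= tnth u j <= 1].

(* Voters are counted by n.+1, as the electorate is nonempty. *)
Record voting_rule (R : realType) (m : nat) := VotingRule {
  rule_prob :> forall n, profile m n.+1 -> 'I_m -> R ;
  rule_prob_ge0 : forall n (p : profile m n.+1) j, 0 <= rule_prob p j ;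
  rule_prob_sum1 : forall n (p : profile m n.+1), \sum_j rule_prob p j = 1
}.

Section distortion.
Context (R : realType) (m : nat).

(* The factor for position k is the probability of choosing s k among the
   candidates j not ranked in the positions before k. *)
Definition plackett_luce (beta : R) (u : m.-tuple R) (s : 'S_m) : R :=
  \prod_(k < m) (expR (beta * tnth u (s k)) /
    \sum_(j < m | (k <= (s^-1)%g j)%N) expR (beta * tnth u j)).

Definition plackett_luce_profile (beta : R) n (U : n.-tuple (m.-tuple R))
    (p : profile m n) : R :=
  \prod_(i < n) plackett_luce beta (tnth U i) (p i).

Definition average_utility n (U : n.-tuple (m.-tuple R)) (j : 'I_m) : R :=
  (\sum_(i < n) tnth (tnth U i) j) / n%:R.

Local Open Scope ereal_scope.

Definition Util (V : probability (utility_vector R m) R) (j : 'I_m) : \bar R :=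
  'E_V[fun u => tnth u j].

(* Given the utilities U, the expectation over the rankings and over the
   internal randomness of f is a finite sum. *)
Definition Util_rule (beta : R) (f : voting_rule R m)
    (V : probability (utility_vector R m) R) (n : nat) : \bar R :=
  'E_(iid V n.+1)[fun U =>
     (\sum_(p : profile m n.+1) plackett_luce_profile beta U p *
        \sum_(j < m) f n p j * average_utility U j)%R].

(* In \bar R, x / 0 = +oo for x > 0. *)
Definition distortion_ratio (x y : \bar R) : \bar R :=
  if (x == 0) && (y == 0) then 1 else x / y.

Definition distortion (beta : R) (f : voting_rule R m) : \bar R :=
  ereal_sup [set limn_esup (fun n => distortion_ratio
                   (\big[maxe/-oo]_(j < m) Util V j) (Util_rule beta f V n))
            | V in [set V : probability (utility_vector R m) R |
                     V (@unit_cube R m) = 1]].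

End distortion.

Section random_dictator.
Context (R : realType) (m : nat).

Definition random_dictator_prob n (p : profile m n.+1) (j : 'I_m) : R :=
  #|[set i | ranked_first (p i) j]%SET|%:R / n.+1%:R.

Lemma random_dictator_prob_ge0 n (p : profile m n.+1) j :
  0 <= random_dictator_prob p j.
Proof. by rewrite divr_ge0. Qed.

Lemma random_dictator_prob_sum1 (m_gt0 : (0 < m)%N) n (p : profile m n.+1) :
  \sum_j random_dictator_prob p j = 1.
Proof.
rewrite -mulr_suml -natr_sum.
have -> : (\sum_j #|[set i | ranked_first (p i) j]%SET| = n.+1)%N.
  under eq_bigr => j _ do rewrite -sum1dep_card.
  rewrite (exchange_big_dep predT)//= -[RHS]card_ord -sum1_card.
  apply: eq_bigr => i _; rewrite (big_pred1 (p i (Ordinal m_gt0)))// => j.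
  by rewrite /= /ranked_first -(inj_eq (@perm_inj _ (p i)^-1%g)) permK -val_eqE.
by rewrite divff// pnatr_eq0.
Qed.

Definition random_dictator (m_gt0 : (0 < m)%N) : voting_rule R m :=
  VotingRule random_dictator_prob_ge0 (random_dictator_prob_sum1 m_gt0).

End random_dictator.

(* Main.v *)
(* Let every voter have utility delta = eps / beta for one candidate g and
   utility 0 for the others.  The Plackett-Luce weight of g is then exp(eps),
   so every voter ranks g first with the same probability
   y = exp(eps) / (exp(eps) + m - 1), for every n.  The ratio is therefore
   delta / (y delta) = 1 + (m - 1) exp(- eps) >= (1 - eps) m.  This holds for
   all beta >= 1. *)
Require Import Defs.
From mathcomp Require Import all_boot all_order all_algebra all_fingroup.
From mathcomp Require Import all_classical all_reals all_analysis.
From mathcomp Require Import measurable_realfun lra.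

Set Implicit Arguments.
Unset Strict Implicit.
Unset Printing Implicit Defensive.
Import Order.TTheory GRing.Theory Num.Theory.

Local Open Scope ring_scope.

(** Deleting [i0] and [j0] makes a permutation with [s i0 = j0] a permutation of one element fewer.
    This peels the top position off a ranking. *)
Lemma sum_lift_perm (V : nmodType) n (i0 j0 : 'I_n.+1) (G : 'S_n.+1 -> V) :
  \sum_(s : 'S_n.+1 | s i0 == j0) G s = \sum_(s : 'S_n) G (lift_perm i0 j0 s).
Proof.
have val_neq (s : 'S_n.+1) k : s i0 != s (lift i0 k).
  by rewrite (inj_eq perm_inj) neq_lift.
(* The default [k] is never reached, by [val_neq]. *)
pose ulift (s : 'S_n.+1) k := odflt k (unlift (s i0) (s (lift i0 k))).
have uliftK (s : 'S_n.+1) k : lift (s i0) (ulift s k) = s (lift i0 k).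
  by rewrite /ulift; case/unlift_some: (val_neq s k) => j -> ->.
have ulift_inj (s : 'S_n.+1) : injective (ulift s).
  move=> k l /(congr1 (lift (s i0))); rewrite !uliftK.
  by move=> /perm_inj /lift_inj.
rewrite (reindex (lift_perm i0 j0)) /=.
  by apply: eq_bigl => s; rewrite lift_perm_id eqxx.
exists (fun s => perm (ulift_inj s)) => [s _|s /eqP si0]; apply/permP => k.
  rewrite permE; apply: (@lift_inj _ (lift_perm i0 j0 s i0)).
  by rewrite uliftK lift_perm_lift lift_perm_id.
case: (unliftP i0 k) => [l|] ->; last by rewrite lift_perm_id si0.
by rewrite lift_perm_lift permE -si0 uliftK.
Qed.

Section ranking_weight.
Context (R : numFieldType).

(** Plackett-Luce with arbitrary weights [w] in place of [expR (beta * u)], so that inductions can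
    pass to [w \o lift j], the weights with candidate [j] removed. *)
Definition ranking_weight m (w : 'I_m -> R) (s : 'S_m) : R :=
  \prod_(k < m) (w (s k) / \sum_(j < m | (k <= (s^-1)%g j)%N) w j).

(** Once [j] takes the top place, the lower positions follow the same model on the remaining
    candidates. *)
Lemma ranking_weight_lift n (w : 'I_n.+1 -> R) j (s : 'S_n) :
  ranking_weight w (lift_perm ord0 j s) =
  w j / (\sum_i w i) * ranking_weight (w \o lift j) s.
Proof.
rewrite /ranking_weight big_ord_recl lift_perm_id; congr (_ * _).
apply: eq_bigr => k _; rewrite lift_perm_lift /=; congr (_ / _).
(* [j] sits in position 0, so it drops out of every later denominator. *)
rewrite big_mkcond (bigD1_ord j)//= lift_permV lift_perm_id ltn0 add0r.
rewrite [RHS]big_mkcond; apply: eq_bigr => i _.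
by rewrite lift_perm_lift.
Qed.

(** Induction on [m], grouping rankings by top candidate: by the induction hypothesis the group of
    [j] contributes [w j / \sum_i w i]. *)
Lemma sum_ranking_weight m (w : 'I_m -> R) : (forall j, 0 < w j) ->
  \sum_s ranking_weight w s = 1.
Proof.
elim: m w => [|n IH] w w_gt0.
  rewrite (big_pred1 1%g) /ranking_weight ?big_ord0// => s.
  by apply/esym/eqP/permP => -[].
rewrite (partition_big (fun s : 'S_n.+1 => s ord0) predT)//=.
rewrite (eq_bigr (fun j => w j / \sum_i w i)); last first.
  move=> j _; rewrite sum_lift_perm.
  under eq_bigr do rewrite ranking_weight_lift.
  by rewrite -mulr_sumr IH ?mulr1// => k; exact: w_gt0.
rewrite -mulr_suml divff// gt_eqF// big_ord_recl ltr_pwDl// sumr_ge0// => i _.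
exact: ltW.
Qed.

Lemma sum_ranking_weight_first m (w : 'I_m -> R) j : (forall j, 0 < w j) ->
  \sum_(s | ranked_first s j) ranking_weight w s = w j / \sum_i w i.
Proof.
case: m w j => [|n] w j w_gt0; first by case: j.
rewrite (eq_bigl (fun s : 'S_n.+1 => s ord0 == j)); last first.
  move=> s; rewrite /ranked_first -[LHS]/((s^-1)%g j == ord0).
  by rewrite -(inj_eq (@perm_inj _ s)) permKV eq_sym.
rewrite sum_lift_perm; under eq_bigr => s _ do rewrite ranking_weight_lift.
by rewrite -mulr_sumr sum_ranking_weight ?mulr1// => k; exact: w_gt0.
Qed.

End ranking_weight.

(** Linearity of expectation: the number of voters ranking [j] first is a sum of indicators, and
    each indicator depends on one ballot only. *)
Lemma expected_random_dictator (R : realType) m (beta : R) n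
    (U : n.+1.-tuple (m.-tuple R)) (j : 'I_m) :
  \sum_(p : profile m n.+1)
    plackett_luce_profile beta U p * random_dictator_prob R p j =
  (\sum_(i < n.+1) (expR (beta * tnth (tnth U i) j) /
     \sum_k expR (beta * tnth (tnth U i) k))) / n.+1%:R.
Proof.
under eq_bigr => p _ do rewrite mulrA -sum1dep_card natr_sum mulr_sumr.
rewrite -mulr_suml (exchange_big_dep predT)//=; congr (_ / _).
apply: eq_bigr => i _.
have w_gt0 i' k : 0 < expR (beta * tnth (tnth U i') k) by exact: expR_gt0.
(* The indicator of voter [i] is absorbed into the factor of [i], so the sum over profiles becomes a
   product of sums over single ballots; all factors but that of [i] equal 1. *)
pose B i' s := plackett_luce beta (tnth U i') s *
  (if i' == i then (ranked_first s j)%:R else 1).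
transitivity (\sum_(p : profile m n.+1) \prod_(i' < n.+1) B i' (p i')).
  rewrite big_mkcond; apply: eq_bigr => p _; rewrite /B big_split/=.
  rewrite -/(plackett_luce_profile _ _ _) -big_mkcond/= big_pred1_eq.
  by case: ranked_first; rewrite ?mulr1 ?mulr0.
rewrite -bigA_distr_bigA /= (bigD1 i)//= [X in _ * X]big1 ?mulr1.
  rewrite -sum_ranking_weight_first// [RHS]big_mkcond; apply: eq_bigr => s _.
  by rewrite /B eqxx; case: ranked_first; rewrite ?mulr1 ?mulr0.
move=> i' /negPf i'i; rewrite -[RHS](sum_ranking_weight (w_gt0 i')).
by apply: eq_bigr => s _; rewrite /B i'i mulr1.
Qed.

(** By induction: integrating the measures of sections against [\d_x] leaves the section at [x], to
    which the hypothesis for [n] applies. *)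
Lemma iid_dirac d (T : measurableType d) (R : realType) (x : T) n
    (A : set (n.-tuple T)) :
  measurable A ->
  iid (\d_x : probability T R) n A = \d_([tuple of nseq n x]) A.
Proof.
elim: n A => [|n IH] A mA /=.
  by rewrite (_ : [tuple] = [tuple of nseq 0 x])//; exact: val_inj.
rewrite /distribution /pushforward.
have mB : measurable (@cons_pair _ T n @^-1` A).
  by rewrite -[X in measurable X]setTI; exact: measurable_cons_pair.
rewrite [LHS]/product_measure1 integral_dirac//; last first.
  exact: measurable_fun_xsection.
rewrite diracT mul1e /= IH; last exact: measurable_xsection.
rewrite !diracE; congr (_%:R)%:E; congr nat_of_bool.
apply/idP/idP; rewrite !inE /xsection/= ?inE /=.
all: by rewrite (_ : cons_pair _ = [tuple of nseq n.+1 x])//; exact: val_inj.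
Qed.

Lemma measurable_plackett_luce (R : realType) m (beta : R) (s : 'S_m) :
  measurable_fun [set: m.-tuple (measurableTypeR R)]
    (fun u : m.-tuple (measurableTypeR R) => plackett_luce beta u s).
Proof.
have mw j : measurable_fun [set: m.-tuple (measurableTypeR R)]
    (fun u : m.-tuple (measurableTypeR R) => expR (beta * tnth u j)).
  apply: measurableT_comp => //; apply: measurable_funM => //.
  exact: measurable_tnth.
apply: measurable_prod => k _; apply: measurable_funM; first exact: mw.
(* Measurability of the inverse, through exp and ln. *)
rewrite (_ : (fun _ => _) = (fun u : m.-tuple (measurableTypeR R) =>
   expR (- ln (\sum_(j < m)
     if (k <= (s^-1)%g j)%N then expR (beta * tnth u j) else 0)))).
  apply: (measurableT_comp (@measurable_expR R)); apply: measurable_funN.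
  apply: (measurableT_comp (@measurable_ln R)).
  by apply: measurable_sum => j; case: (k <= _)%N.
apply/funext => u.
(* The sum is positive because [s k], in position [k], is one of its terms. *)
rewrite -big_mkcond expRN lnK// posrE (bigD1 (s k)) ?permK//=.
by rewrite ltr_pwDl ?expR_gt0// sumr_ge0// => i _; exact: expR_ge0.
Qed.

Lemma Util_dirac (R : realType) m (u : utility_vector R m) (j : 'I_m) :
  Util (\d_u) j = (tnth u j)%:E.
Proof.
rewrite /Util unlock integral_dirac//; first by rewrite diracT mul1e.
by apply/measurable_EFinP; exact: measurable_tnth.
Qed.

(** The electorate is almost surely [n.+1] copies of [u], so the expectation is the value there, and
    each average utility is that of [u]. *)
Lemma Util_rule_dirac (R : realType) m (beta : R) (f : voting_rule R m)
    (u : utility_vector R m) n :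
  Util_rule beta f (\d_u) n =
  (\sum_j (\sum_(p : profile m n.+1)
     plackett_luce_profile beta [tuple of nseq n.+1 u] p * f n p j) * tnth u j)%:E.
Proof.
rewrite /Util_rule unlock.
rewrite (@eq_measure_integral _ _ _ _ \d_([tuple of nseq n.+1 u])); last first.
  by move=> A mA _; exact: iid_dirac.
rewrite integral_dirac//; last first.
  apply/measurable_EFinP; apply: measurable_sum => p.
  apply: measurable_funM.
    apply: measurable_prod => i _.
    apply: (measurableT_comp (@measurable_plackett_luce _ _ _ _)).
    exact: measurable_tnth.
  apply: measurable_sum => j; apply: measurable_funM => //.
  apply: measurable_funM => //; apply: measurable_sum => i.
  apply: (@measurableT_comp _ _ _ _ _ _ (fun v : utility_vector R m => tnth v j)).
    exact: measurable_tnth.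
  exact: measurable_tnth.
rewrite diracT mul1e; congr (_%:E).
under eq_bigr do rewrite mulr_sumr.
rewrite exchange_big/=; apply: eq_bigr => j _.
rewrite mulr_suml; apply: eq_bigr => p _; rewrite -mulrA; congr (_ * (_ * _)).
rewrite /average_utility (eq_bigr (fun=> tnth u j)).
  by rewrite sumr_const card_ord -[X in X / _]mulr_natr mulfK// pnatr_eq0.
by move=> i _; rewrite tnth_nseq.
Qed.

Lemma Util_rule_random_dictator_dirac (R : realType) m (m_gt0 : (0 < m)%N)
    (beta : R) (u : utility_vector R m) n :
  Util_rule beta (random_dictator R m_gt0) (\d_u) n =
  (\sum_j expR (beta * tnth u j) / (\sum_k expR (beta * tnth u k)) * tnth u j)%:E.
Proof.
rewrite Util_rule_dirac; congr (_%:E); apply: eq_bigr => j _; congr (_ * _).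
rewrite expected_random_dictator.
rewrite (eq_bigr (fun=> expR (beta * tnth u j) / \sum_k expR (beta * tnth u k))).
  by rewrite sumr_const card_ord -[X in X / _]mulr_natr mulfK// pnatr_eq0.
by move=> i _; rewrite tnth_nseq.
Qed.

Theorem theorem3p2 (R : realType) (m : nat) (m_ge3 : (3 <= m)%N)
    (eps : R) (eps_gt0 : 0 < eps) (eps_lt : eps < (m%:R - 2) / (m%:R - 1)) :
  exists beta0 : R, forall beta : R, 1 <= beta -> beta0 <= beta ->
    (((1 - eps) * m%:R)%:E
      <= distortion beta (random_dictator R (ltnW (ltnW m_ge3))))%E.
Proof.
exists 1 => beta beta_ge1 _; set m_gt0 := ltnW _.
have beta_gt0 : 0 < beta by exact: lt_le_trans beta_ge1.
have m1_gt0 : 0 < m%:R - 1 :> R by rewrite subr_gt0 ltr1n ltnW.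
have eps_lt1 : eps < 1.
  by rewrite (lt_le_trans eps_lt)// ler_pdivrMr// mul1r lerD2l lerN2 ler1n.
pose delta := eps / beta; pose g := Ordinal m_gt0.
have bdE : beta * delta = eps by rewrite mulrC divfK ?gt_eqF.
have delta_gt0 : 0 < delta by rewrite divr_gt0.
have delta_le1 : delta <= 1.
  by rewrite ler_pdivrMr// mul1r (le_trans (ltW eps_lt1)).
pose u : utility_vector R m := [tuple (if j == g then delta else 0) | j < m].
have uE j : tnth u j = if j == g then delta else 0 by rewrite tnth_mktuple.
pose y := expR eps / (expR eps + (m%:R - 1)).
have y_gt0 : 0 < y by rewrite divr_gt0 ?expR_gt0 // addr_gt0 // expR_gt0.
have yd_gt0 : 0 < y * delta by exact: mulr_gt0.
have ruleE n : Util_rule beta (random_dictator R m_gt0) (\d_u) n = (y * delta)%:E.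
  rewrite Util_rule_random_dictator_dirac (bigD1 g)//= [X in _ + X]big1 ?addr0.
    rewrite uE eqxx; congr (_%:E); congr (_ * _).
    rewrite bdE; congr (_ / _).
    rewrite (bigD1 g)//= uE eqxx bdE; congr (_ + _).
    rewrite (eq_bigr (fun=> 1)); last first.
      by move=> j /negPf jg; rewrite uE jg mulr0 expR0.
    by rewrite sumr_const cardC1 card_ord -subn1 natrB.
  by move=> j /negPf jg; rewrite uE jg mulr0.
(* The supremum is bounded below by its value at the Dirac mass at [u]. *)
apply: (@le_trans _ _ (limn_esup (fun n => distortion_ratio
    (\big[maxe/-oo]_(j < m) Util (\d_u) j)
    (Util_rule beta (random_dictator R m_gt0) (\d_u) n)))%E); last first.
  apply: ereal_sup_ubound; exists \d_u => //=.
  rewrite diracE mem_set// => j; rewrite uE; case: ifP => _.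
    by rewrite delta_le1 ltW.
  by rewrite lexx ler01.
under eq_fun => n do rewrite ruleE.
rewrite is_cvg_limn_esupE; last exact: is_cvg_cst.
(* The denominator is positive, so the convention for 0/0 does not apply. *)
rewrite lim_cst// /distortion_ratio [X in _ && X]eqe (gt_eqF yd_gt0) andbF.
(* It suffices to bound the maximum in the numerator below by the utility [delta] of [g]. *)
apply: (@le_trans _ _ (delta%:E / (y * delta)%:E)%E).
  rewrite inver (gt_eqF yd_gt0) -EFinM lee_fin invfM mulrCA.
  rewrite divff ?gt_eqF// mulr1.
  rewrite /y invf_div [leRHS]mulrDl divff ?gt_eqF ?expR_gt0// -expRN.
  (* From [expR (- eps) >= 1 - eps] the ratio is at least 1 + (m - 1)(1 - eps) = (1 - eps) m +
     eps. *)
  have h : (m%:R - 1) * (1 - eps) <= (m%:R - 1) * expR (- eps).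
    by rewrite ler_wpM2l ?(ltW m1_gt0)// expR_ge1Dx.
  by lra.
apply: lee_wpmul2r.
  by rewrite inver (gt_eqF yd_gt0) lee_fin invr_ge0 ltW.
by apply: (bigmax_sup g) => //; rewrite Util_dirac uE eqxx.
Qed.
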